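(* If $0 < p < \infty$, then $\ell_{p}$ has an infinite-dimensional virtually degenerate linear subspace $W$ without Property E (that is, $W$ contains no pair of disjointly supported non-zero vectors).
   Context: $\ell_p$ is the real or complex sequence space $L_p(\mathbb{N},\text{counting measure})$ with its usual (quasi-)norm. Two vectors are disjointly supported if no coordinate is non-zero for both. A linear subspace $W$ of $\ell_p$ has Property E if there is a pair of disjointly supported non-zero vectors $u,v\in W$. A signed $(s,t)$-simplex in a set $X$ ($s,t>0$ integers) is a collection of (not necessarily distinct) points $x_{1},\ldots,x_{s},y_{1},\ldots,y_{t}\in X$ together with real numbers $m_{1},\ldots,m_{s},n_{1},\ldots,n_{t}$ satisfying $m_{1}+\cdots+m_{s}=n_{1}+\cdots+n_{t}$; it is denoted $D=[x_{j}(m_{j});y_{i}(n_{i})]_{s,t}$. Let $S(D)=\{x_1,\ldots,x_s\}\cup\{y_1,\ldots,y_t\}$. For $z\in S(D)$ put $\mathbf{m}(z)=\sum_{j:x_j=z}m_j$ and $\mathbf{n}(z)=\sum_{i:y_i=z}n_i$ (empty sums are $0$). $D$ is degenerate if $\mathbf{m}(z)=\mathbf{n}(z)$ for all $z\in S(D)$. A non-degenerate signed simplex $D=[x_{j}(m_{j});y_{i}(n_{i})]_{s,t}$ in $\ell_p$ is virtually degenerate if for every coordinate $l\in\mathbb{N}$ the signed simplex $D(l)=[x_{j}(l)(m_{j});y_{i}(l)(n_{i})]_{s,t}$ in the scalar field is degenerate. A linear subspace $W$ is virtually degenerate if there is a virtually degenerate simplex all of whose points lie in $W$. *)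

(* Defs.v *)
From HB Require Import structures.
From mathcomp Require Import all_boot all_order all_algebra.
From mathcomp Require Export complex.
From mathcomp Require Import all_classical all_reals all_analysis.

Set Implicit Arguments.
Unset Strict Implicit.
Unset Printing Implicit Defensive.

Import Order.TTheory GRing.Theory Num.Theory.

Local Open Scope classical_set_scope.
Local Open Scope ring_scope.

(* The scalar field [K] is either [R], with modulus [Num.norm], or [R[i]], with
   the [R]-valued modulus [ComplexField.Normc.normc]. *)
Definition ellp (R : realType) (K : fieldType) (modulus : K -> R) (p : R) :
    set (nat -> K) :=
  [set x : nat -> K | finite_norm (counting : {measure set nat -> \bar R}) p%:E
             (modulus \o x)].

(* [K^o] is [K] as a vector space over itself; sequences then form a vector
   space over [K] pointwise. *)
Definition linear_subspace (K : fieldType) (W : set (nat -> K^o)) : Prop :=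
  GRing.submod_closed (mem W).

Definition finite_dimensional (K : fieldType) (W : set (nat -> K^o)) :
    Prop :=
  exists (n : nat) (b : 'I_n -> nat -> K^o),
    (forall i, W (b i)) /\
    (forall w, W w -> exists c : 'I_n -> K, w = \sum_(i < n) c i *: b i).

Definition infinite_dimensional (K : fieldType) (W : set (nat -> K^o)) :
    Prop :=
  ~ finite_dimensional W.

Definition disjointly_supported (K : fieldType) (u v : nat -> K) : Prop :=
  forall l, ~ (u l != 0 /\ v l != 0).

Definition property_E (K : fieldType) (W : set (nat -> K)) : Prop :=
  exists u v : nat -> K,
    [/\ W u, W v, u <> 0, v <> 0 & disjointly_supported u v].

Record signed_simplex (R : realType) (X : Type) (s t : nat) := SignedSimplex {
  simplex_s_gt0 : (0 < s)%N;
  simplex_t_gt0 : (0 < t)%N;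
  xpoint : 'I_s -> X;
  xweight : 'I_s -> R;
  ypoint : 'I_t -> X;
  yweight : 'I_t -> R;
  weights_balanced : \sum_(j < s) xweight j = \sum_(i < t) yweight i
}.

Definition simplex_points (R : realType) (X : Type) (s t : nat)
    (D : signed_simplex R X s t) : set X :=
  range (xpoint D) `|` range (ypoint D).

Definition mweight (R : realType) (X : eqType) (s t : nat)
    (D : signed_simplex R X s t) (z : X) : R :=
  \sum_(j < s | xpoint D j == z) xweight D j.

Definition nweight (R : realType) (X : eqType) (s t : nat)
    (D : signed_simplex R X s t) (z : X) : R :=
  \sum_(i < t | ypoint D i == z) yweight D i.

Definition degenerate (R : realType) (X : eqType) (s t : nat)
    (D : signed_simplex R X s t) : Prop :=
  forall z, simplex_points D z -> mweight D z = nweight D z.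

(* The signed simplex $D(l)$ in the scalar field. *)
Definition coordinate_simplex (R : realType) (K : Type) (s t : nat)
    (D : signed_simplex R (nat -> K) s t) (l : nat) : signed_simplex R K s t :=
  SignedSimplex (simplex_s_gt0 D) (simplex_t_gt0 D)
    (fun j => xpoint D j l) (fun i => ypoint D i l) (weights_balanced D).

Definition virtually_degenerate_simplex (R : realType) (K : fieldType)
    (s t : nat) (D : signed_simplex R (nat -> K) s t) : Prop :=
  ~ degenerate D /\ forall l, degenerate (coordinate_simplex D l).

(* [R] is the field of the weights, which are real even when [K] is [R[i]]. *)
Definition virtually_degenerate_subspace (R : realType) (K : fieldType)
    (W : set (nat -> K)) : Prop :=
  exists (s t : nat) (D : signed_simplex R (nat -> K) s t),
    simplex_points D `<=` W /\ virtually_degenerate_simplex D.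

(* Main.v *)
(** For fixed [i], the values at infinitely many points of a polynomial deprived
    of its monomial [X^i] determine the polynomial modulo [X^i]. Interleave these
    values for [i = 0, 1, 2], at the points [2^-l], with weights [2^-l] that give
    geometric decay. A nonzero polynomial is killed by at most one of the three
    deletions, so two nonzero polynomials [u], [v] both survive a common one, and
    then the product of the truncations has only finitely many roots: the
    sequences of [u] and [v] are not disjointly supported. On the other hand, each
    coordinate kills one of [1, X, X^2], so it identifies the even vertices of the
    cube spanned by [1, X, X^2] with the odd ones, with multiplicities. *)
Require Import Defs.
From HB Require Import structures.
From mathcomp Require Import all_boot all_order all_algebra.
From mathcomp Require Import all_classical all_reals all_analysis.

Import Order.TTheory GRing.Theory Num.Theory.

Local Open Scope classical_set_scope.
Local Open Scope ring_scope.

Definition drop_monomial (K : nzRingType) (i : nat) (w : {poly K}) : {poly K} :=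
  w - w`_i *: 'X^i.

Lemma drop_monomial_is_linear (K : nzRingType) (i : nat) :
  linear (@drop_monomial K i).
Proof.
move=> c u v; rewrite /drop_monomial coefD coefZ scalerBr scalerDl scalerA.
by rewrite opprD addrACA.
Qed.

HB.instance Definition _ (K : nzRingType) (i : nat) :=
  GRing.isLinear.Build K {poly K} {poly K} _ (@drop_monomial K i)
    (@drop_monomial_is_linear K i).

Lemma drop_monomialXn (K : nzRingType) (i j : nat) :
  drop_monomial K i 'X^j = if i == j then 0 else 'X^j.
Proof.
rewrite /drop_monomial coefXn; case: eqVneq => [->|_].
  by rewrite scale1r subrr.
by rewrite scale0r subr0.
Qed.

(** Such a [w] is a scalar multiple of both ['X^i] and ['X^j]. *)
Lemma drop_monomial_eq0 (K : nzRingType) (i j : nat) (w : {poly K}) :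
  i != j -> drop_monomial K i w = 0 -> drop_monomial K j w = 0 -> w = 0.
Proof.
move=> ij /subr0_eq wi /subr0_eq wj.
by rewrite wi wj coefZ coefXn (negPf ij) mulr0 scale0r.
Qed.

Lemma common_nonzero_drop (K : nzRingType) (u v : {poly K}) :
  u != 0 -> v != 0 ->
  exists2 i : nat, (i < 3)%N &
    drop_monomial K i u != 0 /\ drop_monomial K i v != 0.
Proof.
move=> u0 v0.
have drop2 (w : {poly K}) (i j : nat) : w != 0 -> i != j ->
    drop_monomial K i w = 0 -> drop_monomial K j w != 0.
  by move=> w0 ij wi; apply: contra_neq w0; exact: drop_monomial_eq0 ij wi.
have [u00|u00] := eqVneq (drop_monomial K 0 u) 0.
  have [v10|v10] := eqVneq (drop_monomial K 1 v) 0.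
    by exists 2%N => //; split; [apply: drop2 u00 | apply: drop2 v10].
  by exists 1%N => //; split=> //; apply: drop2 u00.
have [v00|v00] := eqVneq (drop_monomial K 0 v) 0; last by exists 0%N.
have [u10|u10] := eqVneq (drop_monomial K 1 u) 0.
  by exists 2%N => //; split; [apply: drop2 u10 | apply: drop2 v00].
by exists 1%N => //; split=> //; apply: drop2 v00.
Qed.

Lemma poly_nonroot_on_sequence (K : idomainType) (f : nat -> K) (P : {poly K}) :
  injective f -> P != 0 -> exists k, P.[f k] != 0.
Proof.
move=> f_inj P0; apply: contrapT => /forallNP Pf0.
have : all (root P) (map f (iota 0 (size P))).
  apply/allP => _ /mapP[k _ ->].
  by rewrite /root; have [//|Pfk] := boolP (P.[f k] == 0); case: (Pf0 k).
move=> /(max_poly_roots P0); rewrite map_inj_uniq// iota_uniq => /(_ isT).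
by rewrite size_map size_iota ltnn.
Qed.

Definition sample (K : numFieldType) (w : {poly K}) : nat -> K^o :=
  fun l => 2^-1 ^+ l * (drop_monomial K (l %% 3) w).[2^-1 ^+ l].

Lemma sample_is_linear (K : numFieldType) : linear (@sample K).
Proof.
move=> c u v; apply/funext => l.
by rewrite /sample linearP hornerD hornerZ mulrDr mulrCA.
Qed.

HB.instance Definition _ (K : numFieldType) :=
  GRing.isLinear.Build K {poly K} (nat -> K^o) _ (@sample K)
    (@sample_is_linear K).

Lemma sample_overlap (K : numFieldType) (u v : {poly K}) :
  u != 0 -> v != 0 -> exists l, sample K u l != 0 /\ sample K v l != 0.
Proof.
move=> u0 v0; have [i i3 [ui vi]] := common_nonzero_drop K u v u0 v0.
have half_neq0 n : 2^-1 ^+ n != 0 :> K.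
  by rewrite expf_neq0// invr_eq0 pnatr_eq0.
(* The coordinates [k * 3 + i] are those at which [sample] deletes ['X^i]. *)
have f_inj : injective (fun k : nat => 2^-1 ^+ (k * 3 + i) : K).
  move=> j k /ieexprIn; rewrite invr_gt0 ltr0n invr_eq1 pnatr_eq1 => /(_ isT isT).
  by move=> /addIn /eqP; rewrite eqn_mul2r => /eqP.
have [k] := poly_nonroot_on_sequence K _ _ f_inj (mulf_neq0 ui vi).
rewrite hornerM mulf_eq0 negb_or => /andP[uk vk].
exists (k * 3 + i)%N; rewrite /sample modnMDl modn_small//.
by split; exact: mulf_neq0.
Qed.

(** A nonzero [u - v] overlaps with itself, so its sample is nonzero. *)
Lemma sample_inj (K : numFieldType) : injective (@sample K).
Proof.
move=> u v uv; apply/eqP; rewrite -subr_eq0; apply: contraT => w0.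
have [l [+ _]] := sample_overlap K _ _ w0 w0.
by rewrite linearB /= uv subrr eqxx.
Qed.

Lemma range_sample_linear_subspace (K : numFieldType) :
  linear_subspace (range (@sample K)).
Proof.
split=> [|c x y]; rewrite !inE.
  by exists 0 => //; rewrite linear0.
by case=> u _ <- [v _ <-]; exists (c *: u + v) => //; rewrite linearP.
Qed.

Lemma range_sample_infinite_dimensional (K : numFieldType) :
  infinite_dimensional (range (@sample K)).
Proof.
case=> n [b [bW gen]].
have /choice[q qb] i : exists w, sample K w = b i.
  by case: (bW i) => w _; exists w.
(* By injectivity ['X^m], of size [m.+1], would be a combination of polynomials of size at most
   [m]. *)
pose m := \max_(i < n) size (q i).
have [|c] := gen (sample K 'X^m); first by exists 'X^m.
under eq_bigr do rewrite -qb -linearZ.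
rewrite -linear_sum => /sample_inj Xm.
have := size_polyXn K m; rewrite Xm => sz.
have : (size (\sum_(i < n) c i *: q i)%R <= m)%N.
  apply: (leq_trans (poly.size_sum _ _ _)); apply/bigmax_leqP => i _.
  by apply: (leq_trans (size_scale_leq _ _)); exact: leq_bigmax.
by rewrite sz ltnn.
Qed.

Lemma range_sample_not_property_E (K : numFieldType) :
  ~ property_E (range (@sample K)).
Proof.
case=> _ [_ [[u _ <-] [v _ <-] u0 v0 disj]].
have neq0 (w : {poly K}) : sample K w <> 0 -> w != 0.
  by move=> w0; apply/eqP => wE; apply: w0; rewrite wE linear0.
by have [l] := sample_overlap K _ _ (neq0 _ u0) (neq0 _ v0); exact: disj.
Qed.

Definition even_vertex (K : nzRingType) (j : 'I_4) : {poly K} :=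
  nth 0 [:: 0; 1 + 'X; 1 + 'X^2; 'X + 'X^2] j.

Definition odd_vertex (K : nzRingType) (j : 'I_4) : {poly K} :=
  nth 0 [:: 1; 'X; 'X^2; 1 + 'X + 'X^2] j.

(** The balance proof makes every weight [1]. *)
Definition cube_simplex (R : realType) (K : numFieldType) :
    signed_simplex R (nat -> K) 4 4 :=
  SignedSimplex (isT : 0 < 4)%N (isT : 0 < 4)%N
    (fun j => sample K (even_vertex K j)) (fun j => sample K (odd_vertex K j))
    (erefl (\sum_(j < 4) (1 : R))).

Lemma odd_vertex_neq0 (K : numFieldType) (j : 'I_4) : odd_vertex K j != 0.
Proof.
(* The value at [1] counts the monomials of the vertex. *)
suff : 0 < (odd_vertex K j).[1] by apply: contraTneq => ->; rewrite horner0 ltxx.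
by case: j => [[|[|[|[|//]]]] ?]; rewrite /odd_vertex/= !hornerE ?expr1n ?addr_gt0.
Qed.

Lemma cube_simplex_virtually_degenerate (R : realType) (K : numFieldType) :
  virtually_degenerate_simplex (cube_simplex R K).
Proof.
split=> [deg|l z _].
  (* The zero sequence is an even vertex but, by injectivity, not an odd one. *)
  have /deg : simplex_points (cube_simplex R K) (sample K 0) by left; exists ord0.
  rewrite /mweight /nweight/= (bigD1 ord0)//= [RHS]big_pred0 => [/eqP|j].
    by rewrite gt_eqF// ltr_pwDl// sumr_ge0.
  by rewrite (inj_eq (@sample_inj K)); apply: negPf; exact: odd_vertex_neq0.
rewrite /mweight /nweight/= big_mkcond [RHS]big_mkcond/=.
rewrite !big_ord_recl !big_ord0 /even_vertex /odd_vertex/= /sample.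
rewrite !linearD !linear0/=.
(* [1] and ['X] match ['X^0] and ['X^1] up to conversion. *)
rewrite !(drop_monomialXn K _ 0, drop_monomialXn K _ 1, drop_monomialXn).
(* The deletion flattens the cube to a square, each corner of which is the image of one even and one
   odd vertex. Hence both sums have the same terms up to order. *)
move: (l %% 3)%N (ltn_pmod l (isT : (0 < 3)%N)) => [|[|[|//]]] _ /=;
  rewrite !(add0r, addr0).
- by [].
- by rewrite addrCA; do 2 congr +%R; exact: addrC.
- by rewrite [RHS]addrA [RHS]addrCA; congr +%R; exact: addrC.
Qed.

Lemma ellp_geometric (R : realType) (K : fieldType) (modulus : K -> R) (p C : R)
    (x : nat -> K) :
  0 < p -> (forall z, 0 <= modulus z) ->
  (forall l, modulus (x l) <= C * 2^-1 ^+ l) -> ellp modulus p x.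
Proof.
move=> p0 mod0 xC.
have C0 : 0 <= C by have := xC 0%N; rewrite expr0 mulr1; apply: le_trans.
rewrite /ellp/= /finite_norm Lnorm_counting//.
apply: poweR_lty.
set r : R := 2^-1 `^ p.
have r_gt0 : 0 < r by rewrite powR_gt0.
have r_lt1 : `|r| < 1.
  have -> : 1 = 1 `^ p :> R by rewrite powR1.
  rewrite ger0_norm ?powR_ge0//.
  by apply: gt0_ltr_powR; rewrite ?nnegrE ?invf_lt1 ?ltr1n.
apply: (@le_lt_trans _ _ (C `^ p / (1 - r))%:E); last exact: ltry.
apply: lime_le; first by apply: is_cvg_nneseries => *; exact: poweR_ge0.
apply: nearW => n.
apply: (@le_trans _ _ (series (geometric (C `^ p) r) n)%:E); last first.
  by rewrite lee_fin geometric_le_lim// powR_ge0.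
rewrite -sumEFin; apply: lee_sum => k _.
rewrite -[leLHS]/((`|modulus (x k)| `^ p)%:E) lee_fin ger0_norm//=.
(* Swapping the exponents [p] and [k] turns the bound into the [p]-th power of [C * 2^-1 ^+ k]. *)
rewrite -powR_mulrn ?powR_ge0// powRAC powR_mulrn ?invr_ge0//.
rewrite -powRM ?exprn_ge0 ?invr_ge0//.
by apply: ge0_ler_powR; rewrite ?nnegrE ?mulr_ge0 ?exprn_ge0 ?invr_ge0 // ltW.
Qed.

(** The points [2^-1 ^+ l] have modulus at most [1], so the truncations stay bounded there and the
    weights give the decay. An abstract [modulus] serves both fields, since the norm of [R[i]] is
    not [R]-valued. *)
Lemma sample_ellp (R : realType) (K : numFieldType) (modulus : K -> R) (p : R)
    (w : {poly K}) :
  0 < p -> (forall z, 0 <= modulus z) ->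
  (forall x y, modulus (x + y) <= modulus x + modulus y) ->
  (forall x y, modulus (x * y) = modulus x * modulus y) ->
  modulus 0 = 0 -> modulus 1 = 1 -> modulus 2^-1 = 2^-1 ->
  ellp modulus p (sample K w).
Proof.
move=> p0 mod_ge0 modD modM mod0 mod1 mod_half.
have modX x n : modulus (x ^+ n) = modulus x ^+ n.
  by elim: n => [|n IHn]; rewrite ?expr0// !exprS modM IHn.
pose B (P : {poly K}) := \sum_(j < size P) modulus P`_j.
have B_ge0 P : 0 <= B P by exact: sumr_ge0.
have le_B P l : modulus P.[2^-1 ^+ l] <= B P.
  rewrite horner_coef /B.
  elim/big_ind2: _ => [|a b c d ab cd|j _]; first by rewrite mod0.
    exact: le_trans (modD _ _) (lerD ab cd).
  rewrite modM -exprM modX mod_half ler_piMr// exprn_ile1// ?invr_ge0//.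
  by rewrite invf_le1 ?ler1n.
(* Summing over the three deletions gives one bound for all [l]. *)
pose C := \sum_(i < 3) B (drop_monomial K i w).
apply: (@ellp_geometric _ _ _ _ C) => // l.
rewrite /sample modM modX mod_half mulrC ler_wpM2r ?exprn_ge0 ?invr_ge0//.
apply: (le_trans (le_B _ _)).
rewrite /C (bigD1 (Ordinal (ltn_pmod l (isT : (0 < 3)%N))))//=.
by rewrite lerDl sumr_ge0.
Qed.

Theorem theorem6p5 (R : realType) (p : R) (p_gt0 : 0 < p) :
  (exists W : set (nat -> R),
    [/\ W `<=` ellp (fun x : R => `|x|) p,
        linear_subspace W,
        infinite_dimensional W,
        virtually_degenerate_subspace R W &
        ~ property_E W])
  /\
  (exists W : set (nat -> R[i]),
    [/\ W `<=` ellp (@ComplexField.Normc.normc R) p,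
        linear_subspace W,
        infinite_dimensional W,
        virtually_degenerate_subspace R W &
        ~ property_E W]).
Proof.
have main (K : numFieldType) (modulus : K -> R) :
    (forall w, ellp modulus p (sample K w)) ->
    exists W : set (nat -> K),
    [/\ W `<=` ellp modulus p,
        linear_subspace W,
        infinite_dimensional W,
        virtually_degenerate_subspace R W &
        ~ property_E W].
  move=> wp; exists (range (@sample K)); split.
  - by move=> _ [w _ <-].
  - exact: range_sample_linear_subspace.
  - exact: range_sample_infinite_dimensional.
  - exists 4%N, 4%N, (cube_simplex R K); split.
      by move=> _ [] [j _ <-]; eexists.
    exact: cube_simplex_virtually_degenerate.
  - exact: range_sample_not_property_E.
split.
- apply: (main R) => w; apply: sample_ellp => //.
  + exact: ler_normD.
  + exact: normrM.
  + exact: normr0.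
  + exact: normr1.
  + by rewrite ger0_norm// invr_ge0.
apply: (main R[i]) => w; apply: sample_ellp => //.
- by case=> a b; exact: sqrtr_ge0.
- exact: le_normcD.
- exact: ComplexField.Normc.normcM.
- exact: ComplexField.Normc.normc0.
- exact: ComplexField.Normc.normc1.
- by rewrite ComplexField.Normc.normcV normcMn ComplexField.Normc.normc1.
Qed.
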